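(* $L(n)=\Omega((c_l n)^n)$ with $c_l=0.76$; that is, there is a constant $c>0$ such that $L(n)\ge c\,(0.76\,n)^n$ for all $n>1$.
   Context: For $n>1$ let $S'_n$ be a set of $n-1$ elements. For $1\le m<n$, a $Q(m)$-ranking is a function $h:S'_n\to\{0,1,\dots,2m-1\}$ such that every odd number $1,3,\dots,2m-1$ is a value of $h$; $L(n,m)$ is the number of $Q(m)$-rankings and $L(n)=\max_{1\le m<n}L(n,m)$. *)

(* Defs.v *)
From mathcomp Require Import all_boot.

Set Implicit Arguments.
Unset Strict Implicit.
Unset Printing Implicit Defensive.

(* The set of n - 1 elements being ranked is 'I_(n - 1), and the set of
   ranks {0, 1, ..., 2m - 1} is 'I_(2 * m). *)
Definition Q_ranking (n m : nat) (h : {ffun 'I_(n - 1) -> 'I_(2 * m)}) : bool :=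
  [forall k : 'I_(2 * m), odd k ==> (k \in codom h)].

Definition num_Q_rankings (n m : nat) : nat := #|[set h | @Q_ranking n m h]|.

(* The range 1 <= m < n is nonempty exactly when 1 < n; the value is 0
   otherwise. *)
Definition L (n : nat) : nat := \max_(1 <= m < n) num_Q_rankings n m.

(* Main.v *)
Require Import Defs.
From mathcomp Require Import all_boot all_order all_algebra.
From mathcomp Require Import reals.
From mathcomp Require Import zify ring lra.

Set Implicit Arguments.
Unset Strict Implicit.
Unset Printing Implicit Defensive.

Import Order.TTheory GRing.Theory Num.Theory.

Local Open Scope ring_scope.

(** Write b(N, m) for the number of Q(m)-rankings of N elements divided by N!.
    Its generating function in N is f^m with f = e^(2x) - e^x, so the sums
    s(N) = \sum_m b(N, m) satisfy the renewal equation
    s(N) = \sum_(k >= 1) (2^k - 1)/k! s(N - k) and grow like rho^N, where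
    f(1/rho) = 1, that is rho = 1 / ln((1 + sqrt 5)/2) = 2.078...  The maximum
    over m loses only a factor n, and N! behaves like (N/e)^N, so the rate is
    rho/e = 0.7645... The margin over 0.76 pays for the polynomial factors and
    for the rational approximations rho >= 2.07 and e <= 2.719. *)

(** * Counting maps with prescribed values by finite differences *)

Section RankingWeights.
Variable R : realType.

(** The [j]-th backward difference of [y ^+ N / N`!]. For [y = v] it is the
    number of maps from [N] elements to [v] values that hit [j] prescribed
    values, divided by [N`!]. *)
Fixpoint bdiff_pow (N j : nat) (y : R) : R :=
  if j is j'.+1 then bdiff_pow N j' y - bdiff_pow N j' (y - 1)
  else y ^+ N / N`!%:R.

(** The binomial theorem divided by [N!]; differencing commutes with the shift by [a]. *)
Lemma bdiff_pow_shift (N j : nat) (y a : R) :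
  bdiff_pow N j (y + a) =
  \sum_(k < N.+1) a ^+ k / k`!%:R * bdiff_pow (N - k) j y.
Proof.
elim: j y => [|j IHj] y /=.
  rewrite exprDn mulr_suml; apply: eq_bigr => -[k /=]; rewrite ltnS => kN _.
  have -> : N`!%:R = 'C(N, k)%:R * (k`!%:R * (N - k)`!%:R) :> R.
    by rewrite -!natrM bin_fact.
  have nz i : (0 < i)%N -> i%:R != 0 :> R by rewrite pnatr_eq0 lt0n.
  rewrite -mulr_natr; field.
  by rewrite !nz ?fact_gt0 ?bin_gt0.
rewrite addrAC !IHj -sumrB; apply: eq_bigr => k _.
by rewrite mulrBr.
Qed.

(** Induction on the size of [J]; [A] varies because avoiding a value removes it from the
    codomain. *)
Lemma card_ffun_cover (N : nat) (V : finType) (A J : {set V}) : J \subset A ->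
  #|[set h : {ffun 'I_N -> V} | (h \in ffun_on (mem A))
       & [forall k in J, k \in codom h]]|%:R =
  N`!%:R * bdiff_pow N #|J| #|A|%:R.
Proof.
have [j] := ubnP #|J|; elim: j J A => // j IHj J A ltJj sJA.
have [->|[a aJ]] := set_0Vmem J.
  rewrite cards0 /= mulrC divfK ?pnatr_eq0 -?lt0n ?fact_gt0 // -natrX.
  rewrite -[in RHS](card_ord N) -card_ffun_on; congr (_%:R).
  apply: eq_card => h; rewrite inE andb_idr // => _; apply/forall_inP => k.
  by rewrite inE.
have aA := subsetP sJA a aJ.
have JE : #|J| = #|J :\ a|.+1 by rewrite (cardsD1 a) aJ.
have AE : #|A| = #|A :\ a|.+1 by rewrite (cardsD1 a) aA.
rewrite JE /= mulrBr.
have <- : #|A :\ a|%:R = #|A|%:R - 1 :> R by rewrite AE -natr1 addrK.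
rewrite -!IHj; last 4 first.
- by rewrite -ltnS -JE.
- exact: setSD.
- by rewrite -ltnS -JE.
- by apply: subset_trans sJA; apply: subsetDl.
(* The maps covering [J] are those covering [J :\ a], minus those among them
   that avoid [a]. *)
set X := [set h | _]; set Y := [set h | _]; set Z := [set h | _].
suff -> : #|Y| = (#|X| + #|Z|)%N by rewrite natrD addrK.
have -> : X = Y :\: Z.
  apply/setP => h; rewrite in_setD !in_set.
  have [hA|] /= := boolP (h \in ffun_on (mem A)); last by rewrite !andbF.
  apply/forall_inP/andP => [hJ|[]].
    split; last by apply/forall_inP => k; rewrite inE => /andP[_]; apply: hJ.
    rewrite negb_and; apply/orP; left; apply/ffun_onP => hAa.
    have /codomP[i ai] := hJ a aJ; have := hAa i.
    by rewrite -ai inE /= !inE eqxx.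
  move=> nZ /forall_inP hJ k kJ; have [->|ka] := eqVneq k a; last first.
    by apply: hJ; rewrite !inE ka.
  apply: contraR nZ => nah; apply/andP; split; last by apply/forall_inP.
  apply/ffun_onP => i; rewrite !inE; move/ffun_onP: hA => ->.
  rewrite andbT; apply: contra nah => /eqP <-; exact: codom_f.
rewrite addnC -(cardsID Z Y); congr (_ + _)%N.
apply: eq_card => h; rewrite inE andb_idl // !inE => /andP[/ffun_onP hA ->].
by rewrite andbT; apply/ffun_onP => i; have := hA i; rewrite !inE => /andP[].
Qed.

Lemma card_odd_ord m : #|[set k : 'I_(2 * m) | odd k]| = m.
Proof.
rewrite -sum1_card big_mkcond /=.
under eq_bigr do rewrite inE.
elim: m => [|m IHm]; first by rewrite big_ord0.
by rewrite mulnSr addn2 !big_ord_recr /= IHm mul2n odd_double /= addn0 addn1.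
Qed.

Lemma num_Q_rankingsE (n m : nat) :
  (num_Q_rankings n m)%:R = (n - 1)`!%:R * bdiff_pow (n - 1) m (2 * m)%:R.
Proof.
pose J := [set k : 'I_(2 * m) | odd k].
have := @card_ffun_cover (n - 1) _ [set: 'I_(2 * m)] J (subsetT _).
rewrite card_odd_ord cardsT card_ord => <-; congr (_%:R).
apply: eq_card => h; rewrite !in_set.
have -> /= : h \in ffun_on (mem [set: 'I_(2 * m)]).
  by apply/ffun_onP => i; rewrite inE.
by apply: eq_forallb => k; rewrite inE.
Qed.

(** * The renewal inequality and exponential growth *)

Definition ranking_weight (N m : nat) : R := bdiff_pow N m (2 * m)%:R.

Lemma ranking_weight_ge0 N m : 0 <= ranking_weight N m.
Proof.
rewrite -(pmulr_rge0 _ (_ : 0 < N`!%:R)) ?ltr0n ?fact_gt0 //.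
by have := num_Q_rankingsE N.+1 m; rewrite subSS subn0 => <-; apply: ler0n.
Qed.

(** Coefficients of f^(m+1) = (e^(2x) - e^x) f^m: the outermost difference compares shifts of
    [2 * m] by 2 and by 1. *)
Lemma ranking_weightS N m : ranking_weight N m.+1 =
  \sum_(k < N.+1) (2 ^+ k - 1) / k`!%:R * ranking_weight (N - k) m.
Proof.
rewrite /ranking_weight /=.
have -> : (2 * m.+1)%:R = (2 * m)%:R + 2 :> R by rewrite mulnS addnC natrD.
have -> : (2 * m)%:R + 2 - 1 = (2 * m)%:R + 1 :> R by ring.
rewrite !bdiff_pow_shift -sumrB; apply: eq_bigr => k _.
by rewrite expr1n; ring.
Qed.

Definition total_weight N : R := \sum_(m < N.+1) ranking_weight N m.

Lemma total_weight_rec N d : (d <= N)%N ->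
  \sum_(k < d) (2 ^+ k.+1 - 1) / k.+1`!%:R * total_weight (N - k.+1) <=
  total_weight N.
Proof.
move=> dN; rewrite [leRHS]big_ord_recl.
apply: ler_wpDl; first exact: ranking_weight_ge0.
(* The [k = 0] coefficient vanishes, so the convolution starts at [k.+1]. *)
under [leRHS]eq_bigr do
  rewrite /bump /= ranking_weightS big_ord_recl /= subrr mul0r mul0r add0r.
rewrite exchange_big /= (bigID (fun k : 'I_N => (k < d)%N)) /=.
have w_ge0 k : 0 <= (2 ^+ k.+1 - 1) / k.+1`!%:R :> R.
  by rewrite divr_ge0 // subr_ge0 exprn_ege1 ?ler1n.
rewrite -(big_ord_widen_cond N xpredT
  (fun k => \sum_(m < N) (2 ^+ k.+1 - 1) / k.+1`!%:R *
            ranking_weight (N - k.+1) m) dN).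
apply: ler_wpDr.
  by apply: sumr_ge0 => k _; apply: sumr_ge0 => m _;
     rewrite mulr_ge0 ?ranking_weight_ge0.
apply: ler_sum => k _; rewrite -mulr_sumr ler_wpM2l //.
have lekN : ((N - k.+1).+1 <= N)%N.
  by rewrite subnSK ?leq_subr // (leq_trans (ltn_ord k)).
rewrite /total_weight (big_ord_widen _ _ lekN) big_mkcond /=.
by apply: ler_sum => m _; case: ifP; rewrite ?ranking_weight_ge0.
Qed.

(** The first renewal coefficient is 1, so the total weight never decreases. *)
Lemma total_weight_ge1 N : 1 <= total_weight N.
Proof.
elim: N => [|N IHN].
  by rewrite /total_weight big_ord1 /ranking_weight /= expr0 divr1.
apply: le_trans IHN _; have := @total_weight_rec N.+1 1 isT.
rewrite big_ord1 /= subSS subn0.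
have -> : (2 ^+ 1 - 1) / 1`!%:R = 1 :> R by rewrite factS fact0; field.
by rewrite mul1r.
Qed.

(** With [x = 100/207], the sum of the [(2 ^+ k - 1) / k`! * x ^+ k] for
    [1 <= k <= 5] already exceeds 1. *)
Lemma total_weight_ge N : (207 / 100) ^+ N <= (207 / 100) ^+ 5 * total_weight N.
Proof.
have [M] := ubnP N; elim: M N => // M IHM N ltNM.
have [N5|N5] := ltnP N 5.
  rewrite -[leLHS]mulr1 ler_pM ?total_weight_ge1 ?exprn_ge0 //; first lra.
  by rewrite ler_weXn2l // ?(ltnW N5) //; lra.
have := total_weight_rec N5; rewrite -(subnK N5).
set K := (N - 5)%N; set r : R := 207 / 100.
have subE k : (k < 5)%N -> (K + 5 - k.+1 = 4 - k + K)%N by lia.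
(* With [r ^+ K] factored out, the claim is linear in [r ^+ K] and the total weights. *)
have H k : (k < 5)%N ->
    r ^+ (4 - k) * r ^+ K <= r ^+ 5 * total_weight (4 - k + K).
  by move=> k5; rewrite -exprD; apply: IHM; lia.
have := H 0%N isT; have := H 1%N isT; have := H 2%N isT.
have := H 3%N isT; have := H 4%N isT.
under eq_bigr => k _ do rewrite subE //.
rewrite 5!big_ord_recl big_ord0 /= /bump /= !addn0 !add1n !factS fact0 !muln1.
rewrite exprD !subSS !subn0 add0n.
have : 0 <= r ^+ K by rewrite exprn_ge0 // /r; lra.
rewrite /r; lra.
Qed.

(** * Lower bound for the factorial *)

Lemma sum_inv_fact_le n : \sum_(k < n) k`!%:R^-1 <= 2719 / 1000 :> R.
Proof.
(* Counting the last term twice gives a quantity nonincreasing in [i], as 2/(i+8)! <= 1/(i+7)!. *)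
have step i : \sum_(k < i + 8) k`!%:R^-1 + (i + 7)`!%:R^-1 <= 2719 / 1000 :> R.
  elim: i => [|i IHi]; last first.
    apply: le_trans IHi; rewrite addSn big_ord_recr /= -addrA lerD2l.
    rewrite addSn addnS -mulr2n factS natrM invfM -mulrnAl.
    rewrite ler_piMl ?invr_ge0 ?ler0n // -mulr_natl ler_pdivrMr ?ltr0n //.
    by rewrite mul1r ler_nat addnS.
  rewrite !big_ord_recr big_ord0 /= !factS fact0.
  lra.
apply: le_trans (step n); rewrite big_split_ord /= -addrA lerDl addr_ge0 //.
  by apply: sumr_ge0 => k _; rewrite invr_ge0.
by rewrite invr_ge0.
Qed.

(** Termwise in the binomial expansion, C(N, k) / N^k <= 1 / k! with N = n + 1. *)
Lemma compound_le n : (1 + n.+1%:R^-1) ^+ n.+1 <= 2719 / 1000 :> R.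
Proof.
apply: le_trans (sum_inv_fact_le n.+2).
rewrite exprDn; apply: ler_sum => k _; rewrite expr1n mul1r exprVn -mulr_natr.
rewrite mulrC ler_pdivrMr ?exprn_gt0 ?ltr0n // ler_pdivlMl ?ltr0n ?fact_gt0 //.
rewrite -natrM -natrX ler_nat mulnC bin_ffact ffact_prod.
rewrite -[X in (_ <= _ ^ X)%N]card_ord -prod_nat_const.
by apply: leq_prod => i _; apply: leq_subr.
Qed.

Lemma fact_lower_bound n : n%:R ^+ n <= (2719 / 1000) ^+ n * n`!%:R :> R.
Proof.
elim: n => [|[|n] IHn]; first by rewrite !expr0 mulr1.
  by rewrite !expr1; lra.
have -> : n.+2%:R ^+ n.+2 =
    n.+2%:R * (n.+1%:R ^+ n.+1 * (1 + n.+1%:R^-1) ^+ n.+1) :> R.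
  by rewrite -exprMn mulrDr mulr1 divff ?pnatr_eq0 // natr1 exprS.
have -> : (2719 / 1000) ^+ n.+2 * n.+2`!%:R =
    n.+2%:R * ((2719 / 1000) ^+ n.+1 * n.+1`!%:R * (2719 / 1000)) :> R.
  by rewrite factS natrM exprS; ring.
rewrite ler_pM2l ?ltr0n // ler_pM ?compound_le ?exprn_ge0 //.
by rewrite addr_ge0 ?invr_ge0.
Qed.

(** * From the total weight to the maximum *)

Lemma expr_ge_linear (d : R) n : 0 <= d -> n%:R * d <= (1 + d) ^+ n.
Proof.
move=> d0; elim: n => [|n IHn]; first by rewrite mul0r expr0.
have : 1 <= (1 + d) ^+ n by rewrite exprn_ege1 // lerDl.
rewrite exprS -natr1; nra.
Qed.

Lemma total_weight_le_L n : (1 < n)%N ->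
  (n - 1)`!%:R * total_weight (n - 1) <= n%:R * (L n)%:R.
Proof.
move=> n1; rewrite /total_weight mulr_sumr.
under eq_bigr do rewrite -num_Q_rankingsE.
rewrite -natr_sum -natrM ler_nat.
have -> : ((n - 1).+1 = n)%N by lia.
rewrite -[X in (_ <= X * _)%N]card_ord -sum_nat_const.
apply: leq_sum => -[[|m] /= mn] _.
  (* The index [m = 0] lies outside the maximum, but a nonempty set has no map to the empty set. *)
  rewrite /num_Q_rankings eq_card0 // => h.
  have n1' : (0 < n - 1)%N by lia.
  by have [] := h (Ordinal n1').
by rewrite /L (@leq_bigmax_seq _ _ xpredT (num_Q_rankings n)) // mem_index_iota.
Qed.

End RankingWeights.

Theorem theoremA3 (R : realType) :
  exists c : R, 0 < c /\
    forall n : nat, (1 < n)%N -> c * (76 / 100 * n%:R) ^+ n <= (L n)%:R.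
Proof.
(* [d] is chosen so that [(1 + d) ^+ 2 <= r / (q * e)]; by Bernoulli's
   inequality the [n]-th power of the right-hand side is then at least
   [(n * d) ^+ 2], which absorbs the factor [n ^+ 2]. *)
pose d : R := 8 / 10000; pose r : R := 207 / 100.
pose e : R := 2719 / 1000; pose q : R := 76 / 100.
(* Five factors [r] come from [total_weight_ge], the sixth from passing from [n - 1] to [n]. *)
exists (d ^+ 2 / r ^+ 6); split.
  by rewrite divr_gt0 ?exprn_gt0 // /d /r; lra.
rewrite -/q => n n1.
have n0 : 0 < n%:R :> R by rewrite ltr0n; lia.
have r0 : 0 < r by rewrite /r; lra.
have e0 : 0 < e by rewrite /e; lra.
have dn : (n%:R * d) ^+ 2 <= (r / (q * e)) ^+ n.
  apply: (@le_trans _ _ (((1 + d) ^+ n) ^+ 2)).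
    have d_ge0 : 0 <= d by rewrite divr_ge0.
    rewrite lerXn2r ?nnegrE ?expr_ge_linear //.
      by rewrite mulr_ge0 // ltW.
    by rewrite exprn_ge0 // addr_ge0.
  rewrite exprAC; apply: lerXn2r; rewrite ?nnegrE /d /r /e /q.
  - by rewrite exprn_ge0 // addr_ge0 // divr_ge0.
  - by rewrite !(divr_ge0, mulr_ge0).
  - lra.
(* One factor [n] comes from n! = n (n-1)!, the other from bounding the sum over [m] by its
   maximum. *)
have nL : n`!%:R * r ^+ n <= n%:R ^+ 2 * (L n)%:R * r ^+ 6.
  have -> : n`!%:R * r ^+ n = (n%:R * r) * ((n - 1)`!%:R * r ^+ (n - 1)).
    have -> : n = (n - 1).+1 by lia.
    by rewrite factS natrM exprS subSS subn0; ring.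
  have -> : n%:R ^+ 2 * (L n)%:R * r ^+ 6 =
      (n%:R * r) * (r ^+ 5 * (n%:R * (L n)%:R)).
    by ring.
  rewrite ler_pM2l; last exact: mulr_gt0.
  apply: le_trans (ler_wpM2l _ (total_weight_le_L R n1)).
    2: by rewrite exprn_ge0 // ltW.
  by rewrite mulrCA ler_pM2l ?ltr0n ?fact_gt0 // total_weight_ge.
have fn : n%:R ^+ n <= e ^+ n * n`!%:R := fact_lower_bound R n.
have q0 : 0 < q by rewrite divr_gt0.
(* The numerical values are forgotten here; the rest is algebra combining [dn], [nL] and [fn]. *)
move: d r e q r0 e0 q0 dn nL fn => d r e q r0 e0 q0 dn nL fn.
have nr0 : 0 < n%:R ^+ 2 * r ^+ 6 by rewrite mulr_gt0 ?exprn_gt0.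
rewrite -(ler_pM2l nr0); rewrite mulrAC in nL; apply: le_trans nL.
have -> : n%:R ^+ 2 * r ^+ 6 * (d ^+ 2 / r ^+ 6 * (q * n%:R) ^+ n) =
    (n%:R * d) ^+ 2 * (q ^+ n * n%:R ^+ n).
  by rewrite !exprMn; field; rewrite lt0r_neq0.
have -> : n`!%:R * r ^+ n =
    (r / (q * e)) ^+ n * (q ^+ n * (e ^+ n * n`!%:R)).
  rewrite !mulrA -!exprMn mulrC; congr (_ ^+ n * _).
  by field; rewrite !lt0r_neq0.
have qn0 : 0 <= q ^+ n by rewrite exprn_ge0 // ltW.
apply: ler_pM; rewrite ?sqr_ge0 ?ler_wpM2l //.
by rewrite mulr_ge0 // exprn_ge0.
Qed.
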